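(* Let $m\in\mathbb{N}$, $L\in\mathbb{R}_{>0}$, and consider a causal differentiator $\mathcal{D}$ of order $m$ that is exact from the beginning over $\mathcal{F}_0^m$. Then $\mathcal{D}$ is not robust from the beginning over $\mathcal{E}_0$.
   Context: For $m\in\mathbb{N}_0$ and $L,N\ge 0$: $\mathcal{F}^m$ is the set of functions $f:\mathbb{R}_{\ge 0}\to\mathbb{R}$ that are $m$ times continuously differentiable with $f^{(m)}$ Lipschitz continuous; $\mathcal{F}_L^m=\{f\in\mathcal{F}^m: |f^{(m+1)}(t)|\le L\text{ a.e. on }\mathbb{R}_{\ge0}\}$ (so $\mathcal{F}_0^m$ is the set of polynomials of degree at most $m$); $\mathcal{E}_N=\{\eta:\mathbb{R}_{\ge0}\to\mathbb{R}: |\eta(t)|\le N\text{ for all }t\ge0\}$ (so $\mathcal{E}_0$ contains only the zero function); $\mathcal{F}_L^m+\mathcal{E}_N=\{f+\eta: f\in\mathcal{F}_L^m,\eta\in\mathcal{E}_N\}$; and $\mathcal{U}=\bigcup_{m\in\mathbb{N}_0,\,L,N\ge0}(\mathcal{F}_L^m+\mathcal{E}_N)$. A differentiator of order $m$ is an operator $\mathcal{D}:\mathcal{U}\to(\mathbb{R}_{\ge0}\to\mathbb{R}^m)$, with components $\mathcal{D}_1,\dots,\mathcal{D}_m$. It is causal if for all $t\ge0$, $[\mathcal{D}u_1](t)=[\mathcal{D}u_2](t)$ whenever $u_1=u_2$ on $[0,t]$. Worst-case error over $\mathcal{S}\subseteq\mathcal{F}^m$: $M_{N,i}^{\mathcal{S}}(t)=\sup_{f\in\mathcal{S},\,\eta\in\mathcal{E}_N}\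 \sup_{\tau\ge t}|f^{(i)}(\tau)-[\mathcal{D}_i(f+\eta)](\tau)|\in[0,\infty]$. $\mathcal{D}$ is exact from the beginning over $\mathcal{F}_L^m$ if $M_{0,i}^{\mathcal{F}_L^m}(t)=0$ for all $t>0$ and $i=1,\dots,m$. Robustness: for $\mathcal{S}\subseteq\mathcal{U}$ and $\epsilon>0$ let $Q^{\mathcal{S}}_{\epsilon,i}(t)=\sup_{u_1\in\mathcal{S},\,\eta\in\mathcal{E}_\epsilon}\ \sup_{\tau\ge t}|[\mathcal{D}_iu_1](\tau)-[\mathcal{D}_i(u_1+\eta)](\tau)|\in[0,\infty]$ and $Q^{\mathcal{S}}_i(t)=\lim_{\epsilon\to0^+}Q^{\mathcal{S}}_{\epsilon,i}(t)\in[0,\infty]$. $\mathcal{D}$ is robust from the beginning over $\mathcal{S}$ if $Q_i^{\mathcal{S}}(0)=0$ for $i=1,\dots,m$. *)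

(* Defs.v *)
From mathcomp Require Import all_boot all_order all_algebra.
From mathcomp Require Import all_classical all_reals all_analysis.
Import Order.TTheory GRing.Theory Num.Theory.
Import numFieldNormedType.Exports.

Set Implicit Arguments.
Unset Strict Implicit.
Unset Printing Implicit Defensive.

Local Open Scope classical_set_scope.
Local Open Scope ring_scope.

(* [halfline R] coerces to the type {t : R | t \in halfline R}, which carries
   the subspace topology of R; all functions of time live on that type. *)
Definition halfline (R : realType) : set R := [set t : R | 0 <= t].
Arguments halfline R : clear implicits.

Section Derivatives.
Context {R : realType}.
Implicit Types (f : halfline R -> R) (t : halfline R).

(* [t^'] is the punctured neighbourhood filter inside the half-line, so the
   derivative is two-sided at t > 0 and one-sided at t = 0. *)
Definition slope f t : halfline R -> R :=
  fun s => (f s - f t) / (val s - val t).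

Definition hl_derivable f t : Prop := cvg (slope f t s @[s --> t^']).

Definition hl_derive f : halfline R -> R :=
  fun t => lim (slope f t s @[s --> t^']).

Definition hl_deriven (n : nat) f : halfline R -> R := iter n hl_derive f.

Definition continuously_differentiable (m : nat) f : Prop :=
  (forall i t, (i < m)%N -> hl_derivable (hl_deriven i f) t) /\
  continuous (hl_deriven m f).

Definition hl_lipschitz f : Prop :=
  exists k : R, forall s t, `|f s - f t| <= k * `|val s - val t|.

End Derivatives.

Section Signals.
Variable R : realType.

Definition Fclass (m : nat) : set (halfline R -> R) :=
  [set f | continuously_differentiable m f /\ hl_lipschitz (hl_deriven m f)].

(* The derivative of order m.+1 is a junk value where it does not exist, hence
   the bound comes with derivability at almost every t >= 0. *)
Definition FclassL (m : nat) (L : R) : set (halfline R -> R) :=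
  [set f | Fclass m f /\
    (@lebesgue_measure R).-negligible
      (val @` [set t : halfline R |
        ~ (hl_derivable (hl_deriven m f) t /\
           `|hl_deriven m.+1 f t| <= L)])].

Definition noise (N : R) : set (halfline R -> R) :=
  [set eta | forall t, `|eta t| <= N].

Definition FclassL_noise (m : nat) (L N : R) : set (halfline R -> R) :=
  [set f \+ eta | f in FclassL m L & eta in noise N].

Definition signals : set (halfline R -> R) :=
  [set u | exists (m : nat) (L N : R),
    [/\ 0 <= L, 0 <= N & FclassL_noise m L N u]].

(* The domain is exactly the type of the elements of [signals R]. The component
   [i : 'I_m], counted from 0, estimates the derivative of order i.+1. *)
Definition differentiator (m : nat) : Type :=
  signals -> halfline R -> 'rV[R]_m.

End Signals.

Arguments noise {R} N.
Arguments FclassL {R} m L.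
Arguments signals R : clear implicits.
Arguments differentiator R m : clear implicits.

Section Properties.
Context {R : realType} {m : nat}.
Variable D : differentiator R m.

Definition causal : Prop :=
  forall (t : halfline R) (u1 u2 : signals R),
    (forall s : halfline R, val s <= val t -> val u1 s = val u2 s) ->
    D u1 t = D u2 t.

(* [u] is f + eta, as an element of the domain of D. *)
Definition worst_case_error (N : R) (S : set (halfline R -> R)) (i : 'I_m)
    (t : R) : \bar R :=
  ereal_sup [set e | exists (f eta : halfline R -> R) (u : signals R),
    [/\ S f, noise N eta, val u = f \+ eta &
        e = ereal_sup
              [set `|hl_deriven i.+1 f tau - D u tau ord0 i|%:E
              | tau in [set tau : halfline R | t <= val tau]]]].

Definition exact_from_beginning (L : R) : Prop :=
  forall (i : 'I_m) (t : R), 0 < t ->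
    worst_case_error 0 (FclassL m L) i t = 0%E.

Definition robustness_gap (eps : R) (S : set (halfline R -> R)) (i : 'I_m)
    (t : R) : \bar R :=
  ereal_sup [set e | exists (u1 u2 : signals R) (eta : halfline R -> R),
    [/\ S (val u1), noise eps eta, val u2 = val u1 \+ eta &
        e = ereal_sup
              [set `|D u1 tau ord0 i - D u2 tau ord0 i|%:E
              | tau in [set tau : halfline R | t <= val tau]]]].

Definition robustness_limit (S : set (halfline R -> R)) (i : 'I_m) (t : R)
    : \bar R :=
  lim (robustness_gap eps S i t @[eps --> 0^'+]).

Definition robust_from_beginning (S : set (halfline R -> R)) : Prop :=
  forall i : 'I_m, robustness_limit S i 0 = 0%E.

End Properties.

(* Main.v *)
(* The noise t |-> min(t, e) has size e, yet up to time e it coincides with the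
   ramp t |-> t. By causality and exactness on polynomials, at time e the first
   derivative estimate is 1 for this noise and 0 for the zero signal, so the
   robustness gap is at least 1 for every e > 0. *)
Require Import Defs.
From mathcomp Require Import all_boot all_order all_algebra.
From mathcomp Require Import all_classical all_reals all_analysis.
Import Order.TTheory GRing.Theory Num.Theory.
Import numFieldNormedType.Exports.
Local Open Scope classical_set_scope.
Local Open Scope ring_scope.

Section Halfline.
Context {R : realType}.
Implicit Types (t : halfline R) (a b : R).

Definition hl_point {x : R} (x0 : 0 <= x) : halfline R := exist _ x (mem_set x0).

Lemma hl_ge0 t : 0 <= val t.
Proof. by have /set_mem := valP t. Qed.

(** No point of the half-line is isolated: a step to the right never leaves it, even from 0.
    Properness makes limits along [t^'] unique, so [lim] in [hl_derive] can be computed. *)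
#[local] Instance hl_dnbhs_proper t : ProperFilter t^'.
Proof.
apply: Build_ProperFilter_ex => A.
rewrite -[_ A]/(nbhs t [set s | s != t -> A s]) nbhsE => -[B [[C oC CB] Bt] BA].
have : nbhs (val t) C by apply: open_nbhs_nbhs; split=> //; move: Bt; rewrite -CB.
move=> /nbhs_ballP[e /= e0 eC].
(* The witness lies to the right of [t], half-way inside the ball of radius [e]. *)
have s0 : 0 <= val t + e / 2 by rewrite addr_ge0 ?hl_ge0// ltW// divr_gt0.
exists (hl_point s0); apply: BA; last first.
  apply/eqP => /(congr1 val) /= /eqP.
  by rewrite -subr_eq0 addrC addKr gt_eqF// divr_gt0.
rewrite -CB; apply: eC; rewrite /ball /= opprD addNKr normrN gtr0_norm ?divr_gt0//.
by rewrite ltr_pdivrMr// ltr_pMr// ltr1n.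
Qed.

Definition affine a b : halfline R -> R := fun t => a * val t + b.

Lemma slope_affine a b t : \forall s \near t^', slope (affine a b) t s = a.
Proof.
near=> s.
have st : s != t by near: s; exact: nbhs_dnbhs_neq.
rewrite /slope /affine opprD addrACA subrr addr0 -mulrBr mulfK//.
by rewrite subr_eq0 (inj_eq val_inj).
Unshelve. all: by end_near. Qed.

Lemma affine_derivable a b t : hl_derivable (affine a b) t.
Proof. by apply: (cvgP a); apply: cvg_near_cst; exact: slope_affine. Qed.

(** The constant derivative is kept in the form [affine 0 a], so that the rule applies again to
    higher derivatives. *)
Lemma hl_derive_affine a b : hl_derive (affine a b) = affine 0 a.
Proof.
apply/funext => t; rewrite {2}/affine mul0r add0r /hl_derive.
by apply: lim_near_cst => //; exact: slope_affine.
Qed.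

Lemma hl_deriven_affine n a b :
  hl_deriven n.+1 (affine a b) = affine 0 (if n is 0%N then a else 0).
Proof.
elim: n => [|n IHn]; first exact: hl_derive_affine.
by rewrite [LHS](congr1 hl_derive IHn) hl_derive_affine.
Qed.

Lemma affine_FclassL m a b : (0 < m)%N -> FclassL m 0 (affine a b).
Proof.
case: m => // m _; split; first split.
- split=> [[|i] t _|].
  + exact: affine_derivable.
  + by rewrite hl_deriven_affine; exact: affine_derivable.
  + rewrite hl_deriven_affine (_ : affine _ _ = cst (if m is 0%N then a else 0)).
      exact: cst_continuous.
    by apply/funext => t; rewrite /affine mul0r add0r.
- exists 0 => s t; rewrite hl_deriven_affine /affine !mul0r !add0r subrr.
  by rewrite normr0.
(* The next derivative exists and vanishes everywhere, so the exceptional set is empty. *)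
- rewrite (_ : val @` _ = set0); first exact: negligible_set0.
  rewrite -subset0 => x [t + _]; apply; split.
    by rewrite hl_deriven_affine; exact: affine_derivable.
  by rewrite hl_deriven_affine /affine mul0r add0r normr0.
Qed.

Definition to_signal {u : halfline R -> R} (uS : signals R u) : signals R :=
  exist _ u (mem_set uS).

Lemma FclassL_noise_signal m (L N : R) (f eta : halfline R -> R) :
  0 <= L -> 0 <= N -> FclassL m L f -> noise N eta -> signals R (f \+ eta).
Proof.
by move=> L0 N0 fL etaN; exists m, L, N; split=> //; exists f => //; exists eta.
Qed.

Lemma affine_noise_signal a b (N : R) (eta : halfline R -> R) :
  0 <= N -> noise N eta -> signals R (affine a b \+ eta).
Proof.
by move=> N0; apply: (@FclassL_noise_signal 1 0) => //; exact: affine_FclassL.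
Qed.

Lemma noise0 (N : R) : 0 <= N -> noise N (cst 0 : halfline R -> R).
Proof. by move=> N0 t; rewrite normr0. Qed.

Lemma affine_signal a b : signals R (affine a b).
Proof.
rewrite (_ : affine a b = affine a b \+ cst 0); last first.
  by apply/funext => t /=; rewrite addr0.
by apply: (@affine_noise_signal _ _ 0) => //; exact: noise0.
Qed.

End Halfline.

Section Differentiator.
Context {R : realType} {m : nat}.
Variable D : differentiator R m.

(** The pointwise error at [tau] is one term of the double supremum with zero noise and threshold
    [val tau]. Exactness makes that supremum 0, but only for positive thresholds. *)
Lemma exact_from_beginning_eq (L : R) (i : 'I_m) (u : signals R) (tau : halfline R) :
  exact_from_beginning D L -> FclassL m L (val u) -> 0 < val tau ->
  D u tau ord0 i = hl_deriven i.+1 (val u) tau.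
Proof.
move=> exD uL tau0; apply/esym/eqP; rewrite -subr_eq0 -normr_le0 -lee_fin.
rewrite -[leRHS](exD i _ tau0).
apply: le_trans; last first.
  apply: ereal_sup_ubound; exists (val u), (cst 0), u; split=> //.
    exact: noise0.
  by apply/funext => t /=; rewrite addr0.
by apply: ereal_sup_ubound; exists tau => //=.
Qed.

(** A larger noise bound admits more perturbations, so the outer supremum runs over a larger set. *)
Lemma robustness_gap_homo (S : set (halfline R -> R)) (i : 'I_m) (t : R) :
  {homo (fun eps => robustness_gap D eps S i t) : x y / x <= y >-> (x <= y)%E}.
Proof.
move=> x y xy; apply: le_ereal_sup => _ [u1 [u2 [eta [Su1 etax u2E ->]]]].
exists u1, u2, eta; split=> // s; exact: le_trans (etax s) xy.
Qed.

(* [lim] is a junk value on a divergent filter; the gap converges as e decreases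
   to 0 because it is monotone in e. *)
Lemma robustness_limit_ge (S : set (halfline R -> R)) (i : 'I_m) (t : R) l :
  (forall eps, 0 < eps -> (l <= robustness_gap D eps S i t)%E) ->
  (l <= robustness_limit D S i t)%E.
Proof.
move=> lS; apply: lime_ge.
  apply: nondecreasing_at_right_is_cvge; near=> e => x y _ _.
  exact: robustness_gap_homo.
near=> eps; apply: lS; near: eps; exact: nbhs_right_gt.
Unshelve. all: by end_near. Qed.

End Differentiator.

Theorem proposition3p6 (R : realType) (m : nat) (L : R)
    (D : differentiator R m) :
  (0 < m)%N -> 0 < L ->
  causal D ->
  exact_from_beginning D 0 ->
  ~ robust_from_beginning D (noise 0).
Proof.
move=> m0 _ cD exD rD; pose i := Ordinal m0.
suff : (1%:E <= robustness_limit D (noise 0) i 0)%E by rewrite rD lee_fin ler10.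
apply: robustness_limit_ge => e e0.
pose eta (t : halfline R) := Num.min (val t) e.
have etae : noise e eta.
  move=> t; rewrite ger0_norm ?ge_min ?lexx ?orbT//.
  by rewrite le_min hl_ge0 ltW.
pose z : signals R := to_signal (affine_signal 0 0).
pose ramp : signals R := to_signal (affine_signal 1 0).
(* Keeping the summand [affine 0 0] gives [u] literally the shape of [z] plus noise that
   [robustness_gap] asks for. *)
pose u : signals R :=
  to_signal (affine_noise_signal 0 0 _ _ (ltW e0) etae).
(* Time [e] is the last one at which [eta] still equals the ramp, and it is positive, as exactness
   requires. *)
pose tau := hl_point (ltW e0).
have Dz : D z tau ord0 i = 0.
  rewrite (exact_from_beginning_eq D 0)//; last exact: affine_FclassL.
  by rewrite hl_deriven_affine /affine mul0r add0r.
have Du : D u tau ord0 i = 1.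
  rewrite (cD tau u ramp); last first.
    by move=> s /= se; rewrite /affine /eta mul0r !addr0 add0r mul1r min_l.
  rewrite (exact_from_beginning_eq D 0)//; last exact: affine_FclassL.
  by rewrite hl_deriven_affine /affine mul0r add0r.
(* The outer supremum is bounded below by the pair [z], [u], and the inner one by its term at
   [tau]. *)
apply: le_trans; last first.
  apply: ereal_sup_ubound; exists z, u, eta; split=> //.
  by move=> t /=; rewrite /affine mul0r addr0 normr0.
apply: ereal_sup_ubound; exists tau => /=; first exact: ltW.
by rewrite Dz Du sub0r normrN normr1.
Qed.
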